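(* Let $\mathfrak g$ be a perfect Lie algebra over a field $F$. Let $U_{LTS}(\mathfrak g)$, $U_{Leib}(\mathfrak g)$ and $U_{Lie}(\mathfrak g)$ be the universal central extensions of $\mathfrak g$ considered as a Lie triple system, as a Leibniz algebra, and as a Lie algebra, respectively. Then $$U_{LTS}(\mathfrak g)\cong U_{Leib}(\mathfrak g)\quad\text{if } \operatorname{char} F=2,$$ $$U_{LTS}(\mathfrak g)\cong U_{Lie}(\mathfrak g)\quad\text{if } \operatorname{char} F\neq 2.$$ In other words, the universal central extension of $\mathfrak g$ in the category of Lie triple systems is isomorphic to the universal central extension of $\mathfrak g$ as a Lie algebra if $\operatorname{char} F\ne 2$, and to the universal central extension of $\mathfrak g$ as a Leibniz algebra if $\operatorname{char} F=2$. Here the isomorphisms are isomorphisms of Lie triple systems compatible with the projections onto $\mathfrak g$, where $U_{Lie}(\mathfrak g)$ (resp. $U_{Leib}(\mathfrak g)$ when $\operatorname{char} F=2$) carries the ternary bracket $\{x,y,z\}=[x,[y,z]]$.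
   Context: All vector spaces and homomorphisms are over the field $F$ (of any dimension). A Lie algebra is a vector space with a bilinear bracket satisfying $[x,x]=0$ and the Jacobi identity. It is perfect if $\mathfrak g=[\mathfrak g,\mathfrak g]$. A (right) Leibniz algebra is a vector space $\mathfrak h$ with a bilinear bracket satisfying $[x,[y,z]]=[[x,y],z]-[[x,z],y]$ for all $x,y,z\in\mathfrak h$. Every Lie algebra is a Leibniz algebra. A Lie triple system is a vector space $L$ with a trilinear bracket $\{-,-,-\}:L\otimes L\otimes L\to L$ such that for all $x,y,z,a,b\in L$: $\{x,y,y\}=0$; $\{x,y,z\}+\{y,z,x\}+\{z,x,y\}=0$; $\{\{x,y,z\},a,b\}=\{\{x,a,b\},y,z\}+\{x,\{y,a,b\},z\}+\{x,y,\{z,a,b\}\}$. Every Lie algebra $\mathfrak g$ is a Lie triple system via $\{x,y,z\}=[x,[y,z]]$. A central extension of a Lie triple system $\mathfrak g$ is a short exact sequence of Lie triple systems $0\to K\to L\to\mathfrak g\to 0$ with $\{L,L,K\}=0$ (this implies $\{L,K,L\}=\{K,L,L\}=0$). A central extension of Lie (resp. Leibniz) algebras is a short exact sequence $0\to K\to L\to\mathfrak g\to0$ of Lie (resp. Leibniz) algebras with $[L,K]=[K,L]=0$. In each of the three categories, a central extension $U\to\mathfrak g$ is universal if for every central extension $L\to\mathfrak g$ in that category there is a unique homomorphism $U\to L$ commuting with the projections to $\mathfrak g$; for a perfect Lie algebra $\mathfrak g$ the universal central extension exists in each of the three categories. *)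

(* Defs.v *)
From HB Require Import structures.
From mathcomp Require Import all_boot all_order all_algebra.

Set Implicit Arguments.
Unset Strict Implicit.
Unset Printing Implicit Defensive.

Import GRing.Theory.
Local Open Scope ring_scope.

Record lieAlgebra (F : fieldType) := LieAlgebra {
  lie_sort :> lmodType F;
  lie_br : {bilinear lie_sort -> lie_sort -> lie_sort};
  lie_alt : forall x, lie_br x x = 0;
  lie_jacobi : forall x y z,
    lie_br x (lie_br y z) + lie_br y (lie_br z x) + lie_br z (lie_br x y) = 0
}.

Record leibnizAlgebra (F : fieldType) := LeibnizAlgebra {
  leib_sort :> lmodType F;
  leib_br : {bilinear leib_sort -> leib_sort -> leib_sort};
  leib_identity : forall x y z,
    leib_br x (leib_br y z)
      = leib_br (leib_br x y) z - leib_br (leib_br x z) y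
}.

(* The axioms are kept as a predicate on a ternary operation because the
   ternary bracket of a Leibniz algebra satisfies them only in some cases. *)
Record lts_axioms (F : fieldType) (L : lmodType F) (t : L -> L -> L -> L)
    : Prop := LtsAxioms {
  lts_linear1 : forall y z, linear (fun x => t x y z);
  lts_linear2 : forall x z, linear (fun y => t x y z);
  lts_linear3 : forall x y, linear (fun z => t x y z);
  lts_alt : forall x y, t x y y = 0;
  lts_cyclic : forall x y z, t x y z + t y z x + t z x y = 0;
  lts_derivation : forall x y z a b,
    t (t x y z) a b = t (t x a b) y z + t x (t y a b) z + t x y (t z a b)
}.

Record lieTripleSystem (F : fieldType) := LieTripleSystem {
  lts_sort :> lmodType F;
  lts_br : lts_sort -> lts_sort -> lts_sort -> lts_sort;
  ltsP : lts_axioms lts_br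
}.

Record lie_hom (F : fieldType) (L M : lieAlgebra F) := LieHom {
  lie_map :> {linear L -> M};
  lie_hom_br : forall x y,
    lie_map (lie_br L x y) = lie_br M (lie_map x) (lie_map y)
}.

Record leib_hom (F : fieldType) (L M : leibnizAlgebra F) := LeibHom {
  leib_map :> {linear L -> M};
  leib_hom_br : forall x y,
    leib_map (leib_br L x y) = leib_br M (leib_map x) (leib_map y)
}.

Record lts_hom (F : fieldType) (L M : lieTripleSystem F) := LtsHom {
  lts_map :> {linear L -> M};
  lts_hom_br : forall x y z,
    lts_map (lts_br x y z) = lts_br (lts_map x) (lts_map y) (lts_map z)
}.

Lemma lie_anticomm (F : fieldType) (g : lieAlgebra F) (x y : g) :
  lie_br g x y = - lie_br g y x.
Proof.
apply/eqP; rewrite -addr_eq0; apply/eqP.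
by have := lie_alt (x + y); rewrite linearDl !linearDr !lie_alt add0r addr0.
Qed.

Lemma lie_leibniz_identity (F : fieldType) (g : lieAlgebra F) (x y z : g) :
  lie_br g x (lie_br g y z)
    = lie_br g (lie_br g x y) z - lie_br g (lie_br g x z) y.
Proof.
rewrite (lie_anticomm (lie_br g x y)) (lie_anticomm (lie_br g x z)) opprK.
rewrite (lie_anticomm x z) linearNr.
by have /eqP := lie_jacobi x y z; rewrite -addrA addr_eq0 opprD addrC => /eqP.
Qed.

Definition leibniz_of_lie (F : fieldType) (g : lieAlgebra F)
  : leibnizAlgebra F := LeibnizAlgebra (@lie_leibniz_identity F g).

Definition lie_ternary (F : fieldType) (g : lieAlgebra F) (x y z : g) : g :=
  lie_br g x (lie_br g y z).

Definition leib_ternary (F : fieldType) (h : leibnizAlgebra F) (x y z : h)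
  : h := leib_br h x (leib_br h y z).

Lemma lie_ternaryP (F : fieldType) (g : lieAlgebra F) :
  lts_axioms (@lie_ternary F g).
Proof.
rewrite /lie_ternary; split.
- by move=> y z c u v; rewrite linearPl.
- by move=> x z c u v; rewrite linearPl linearPr.
- by move=> x y c u v; rewrite !linearPr.
- by move=> x y; rewrite lie_alt linear0r.
- exact: lie_jacobi.
move=> x y z a b; set t := lie_br g a b.
have D u v :
    lie_br g (lie_br g u v) t = lie_br g (lie_br g u t) v + lie_br g u (lie_br g v t).
  by rewrite (lie_leibniz_identity u v t) addrC subrK.
by rewrite !D linearDr addrA.
Qed.

Definition lts_of_lie (F : fieldType) (g : lieAlgebra F) : lieTripleSystem F :=
  LieTripleSystem (lie_ternaryP g).

Definition lts_of_leibniz (F : fieldType) (h : leibnizAlgebra F)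
  (H : lts_axioms (@leib_ternary F h)) : lieTripleSystem F :=
  LieTripleSystem H.

Definition perfect (F : fieldType) (g : lieAlgebra F) : Prop :=
  forall x : g, exists (n : nat) (c : 'I_n -> F) (a b : 'I_n -> g),
    x = \sum_(i < n) c i *: lie_br g (a i) (b i).

(* An extension 0 -> K -> L -> M -> 0 is given by the surjection p : L -> M,
   with K the kernel of p. *)
Definition lie_central_ext (F : fieldType) (L M : lieAlgebra F)
    (p : lie_hom L M) : Prop :=
  (forall y, exists x, p x = y) /\
  (forall x k, p k = 0 -> lie_br L x k = 0 /\ lie_br L k x = 0).

Definition leib_central_ext (F : fieldType) (L M : leibnizAlgebra F)
    (p : leib_hom L M) : Prop :=
  (forall y, exists x, p x = y) /\
  (forall x k, p k = 0 -> leib_br L x k = 0 /\ leib_br L k x = 0).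

Definition lts_central_ext (F : fieldType) (L M : lieTripleSystem F)
    (p : lts_hom L M) : Prop :=
  (forall y, exists x, p x = y) /\
  (forall x y k, p k = 0 -> lts_br x y k = 0).

Definition lie_universal_ext (F : fieldType) (U g : lieAlgebra F)
    (p : lie_hom U g) : Prop :=
  lie_central_ext p /\
  forall (L : lieAlgebra F) (q : lie_hom L g), lie_central_ext q ->
    exists f : lie_hom U L,
      (forall x, q (f x) = p x) /\
      (forall f' : lie_hom U L, (forall x, q (f' x) = p x) -> f' =1 f).

Definition leib_universal_ext (F : fieldType) (U g : leibnizAlgebra F)
    (p : leib_hom U g) : Prop :=
  leib_central_ext p /\
  forall (L : leibnizAlgebra F) (q : leib_hom L g), leib_central_ext q ->
    exists f : leib_hom U L,
      (forall x, q (f x) = p x) /\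
      (forall f' : leib_hom U L, (forall x, q (f' x) = p x) -> f' =1 f).

Definition lts_universal_ext (F : fieldType) (U g : lieTripleSystem F)
    (p : lts_hom U g) : Prop :=
  lts_central_ext p /\
  forall (L : lieTripleSystem F) (q : lts_hom L g), lts_central_ext q ->
    exists f : lts_hom U L,
      (forall x, q (f x) = p x) /\
      (forall f' : lts_hom U L, (forall x, q (f' x) = p x) -> f' =1 f).

Definition lts_iso_over (F : fieldType) (U V : lieTripleSystem F) (T : Type)
    (p : U -> T) (q : V -> T) : Prop :=
  exists f : lts_hom U V, bijective f /\ (forall x, q (f x) = p x).

(* Main.v *)
Require Import Defs.
From HB Require Import structures.
From mathcomp Require Import all_boot all_order all_algebra.
From Stdlib Require Import ClassicalEpsilon.

Set Implicit Arguments.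
Unset Strict Implicit.
Unset Printing Implicit Defensive.

Import GRing.Theory.
Local Open Scope ring_scope.

(** Let p : U -> g be a central extension of Lie triple systems, with g a
    perfect Lie algebra.  The whole proof rests on the fact that the ternary
    bracket of U comes from a binary one: U has a bilinear bracket br, lifting
    that of g, with br x (br y z) = {x, y, z}
    ([leibniz_bracket_of_lts_ext]).  Since g is perfect, p y is a sum of
    brackets [p a, p b], and br x y has to be the corresponding sum of the
    {x, a, b}.  For this to be well defined, a formal sum s of pairs (a, b)
    with bracket 0 in g must satisfy {x, s} = 0 for all x.  The derivation
    identity expands {{x, y, z}, s} into brackets each of which has an entry
    {x, s}, {y, s} or {z, s}; these entries lie over 0, hence are central, so
    {{x, y, z}, s} = 0; and since g = [g, [g, g]], the triple products span U
    modulo its central kernel.  In terms of br the derivation identity is then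
    the Leibniz identity.

    It remains to see what the cyclic identity of Lie triple systems says
    about br.  In any Leibniz central extension of g, the cyclic sum A of
    [x, [y, z]] and the cyclic sum B of [[x, y], z] satisfy A = 2 B
    ([leib_ternary_cyclic_sum]).  In characteristic 2 this makes A = 0
    automatic: every Leibniz central extension of g is a Lie triple system
    ([leib_ternaryP_pchar2]), so that central extensions in the two categories
    correspond to each other.  In other characteristics A = 0 forces B = 0,
    which amounts to [x, [y, z]] = - [[y, z], x]; so br is antisymmetric, hence
    alternating, and U is a Lie algebra ([leib_ext_alternating]).

    Thus a universal U receives a map from, and maps to, the universal
    extension of the other category.  Both maps are homomorphisms for both
    kinds of brackets, because a linear map over g that preserves the ternary
    brackets preserves the binary ones ([ternary_hom_leib]), and uniqueness in
    the universal properties makes them mutually inverse. *)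

(** * Induction along an extension of a perfect Lie algebra *)

Section ExtensionInduction.
Variables (F : fieldType) (g : lieAlgebra F) (g_perfect : perfect g).

(** Perfectness is used through this induction principle rather than through
    explicit sums of brackets. *)
Lemma perfect_ind (P : g -> Prop) :
    (forall c u v, P u -> P v -> P (c *: u + v)) ->
    (forall a b, P (lie_br g a b)) ->
  forall w, P w.
Proof.
move=> Plin Pbr w; have [n [c [a [b ->]]]] := g_perfect w.
elim/big_rec: _ => [|i u _ Pu]; last exact: Plin.
by rewrite -(lie_alt 0); apply: Pbr.
Qed.

Variables (U : lmodType F) (p : {linear U -> g}).
Hypothesis p_surj : forall y, exists x, p x = y.

(** A property closed under linear combinations passes from generators modulo
    the kernel of p to all of U, provided that it holds for every preimage of
    each generator.  The kernel is covered by a = b = 0. *)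
Lemma ext_ind (P : U -> Prop) :
    (forall c u v, P u -> P v -> P (c *: u + v)) ->
    (forall y a b, p y = lie_br g (p a) (p b) -> P y) ->
  forall y, P y.
Proof.
move=> Plin Pbr y; move: {2}(p y) (erefl (p y)) => w.
elim/perfect_ind: w y => [c w1 w2 P1 P2 | a' b'] y py.
  have [y1 py1] := p_surj w1.
  (* y - c y1 is the lift of w2 matching the lift y1 of w1. *)
  rewrite -[y](subrKC (c *: y1)); apply: Plin; first exact: P1.
  by apply: P2; rewrite linearB linearZ py py1 addrC addKr.
have [[a pa] [b pb]] := (p_surj a', p_surj b').
by apply: (Pbr _ a b); rewrite py pa pb.
Qed.

(** The same principle based on g = [g, [g, g]]. *)
Lemma ext_ind2 (P : U -> Prop) :
    (forall c u v, P u -> P v -> P (c *: u + v)) ->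
    (forall y a b c, p y = lie_br g (p a) (lie_br g (p b) (p c)) -> P y) ->
  forall y, P y.
Proof.
move=> Plin Pbr; apply: ext_ind => // y a b.
elim/ext_ind: b y => [c u v Pu Pv | b b1 b2 pb] y py; last first.
  by apply: (Pbr _ a b1 b2); rewrite py pb.
have [y1 py1] := p_surj (lie_br g (p a) (p u)).
rewrite -[y](subrKC (c *: y1)); apply: Plin; first exact: Pu.
apply: Pv; rewrite linearB linearZ py py1.
by rewrite linearP linearPr addrC addKr.
Qed.

End ExtensionInduction.

(** * The Leibniz bracket of a central extension of Lie triple systems *)

Section FormalSums.
Variables (F : fieldType) (U V : lmodType F).
Implicit Types (f : U -> U -> V) (s : seq (F * U * U)).

(** A triple (c, a, b) stands for the term c (a, b) of an element of the free
    vector space on pairs; eval_sum f is the linear extension of f. *)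
Definition eval_sum f s : V := \sum_(t <- s) t.1.1 *: f t.1.2 t.2.

Definition scale_sum (c : F) s := [seq (c * t.1.1, t.1.2, t.2) | t <- s].

Lemma eval_sum1 f a b : eval_sum f [:: (1, a, b)] = f a b.
Proof. by rewrite /eval_sum big_seq1 scale1r. Qed.

Lemma eval_cat f s1 s2 : eval_sum f (s1 ++ s2) = eval_sum f s1 + eval_sum f s2.
Proof. exact: big_cat. Qed.

Lemma eval_scale f c s : eval_sum f (scale_sum c s) = c *: eval_sum f s.
Proof.
rewrite /eval_sum big_map scaler_sumr.
by apply: eq_bigr => t _; rewrite scalerA.
Qed.

End FormalSums.

Section LeibnizBracket.
Variables (F : fieldType) (g : lieAlgebra F) (g_perfect : perfect g).
Variables (U : lieTripleSystem F) (p : lts_hom U (lts_of_lie g)).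
Hypothesis p_central : lts_central_ext p.

Local Notation "{ x , y , z }" := (lts_br x y z).
Local Notation pbr := (fun a b : U => lie_br g (p a) (p b)).

Let p_surj : forall y : g, exists x, p x = y := p_central.1.

Let ax := ltsP U.

Let tern_P1 c u v y z : {c *: u + v, y, z} = c *: {u, y, z} + {v, y, z} :> U.
Proof. exact: (lts_linear1 ax). Qed.
Let tern_P2 c u v x z : {x, c *: u + v, z} = c *: {x, u, z} + {x, v, z} :> U.
Proof. exact: (lts_linear2 ax). Qed.
Let tern_P3 c u v x y : {x, y, c *: u + v} = c *: {x, y, u} + {x, y, v} :> U.
Proof. exact: (lts_linear3 ax). Qed.

Let p_tern x y z : p {x, y, z} = lie_br g (p x) (lie_br g (p y) (p z)).
Proof. exact: lts_hom_br. Qed.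

Let tern_kernel3 x y k : p k = 0 -> {x, y, k} = 0 :> U.
Proof. exact: p_central.2. Qed.

Let tern_kernel2 x k y : p k = 0 -> {x, k, y} = 0 :> U.
Proof.
move=> pk; have := lts_alt ax x (1 *: k + y).
rewrite tern_P2 !tern_P3 !(lts_alt ax) (tern_kernel3 _ _ pk) !scale1r.
by rewrite !addr0 add0r.
Qed.

Let tern_kernel1 k x y : p k = 0 -> {k, x, y} = 0 :> U.
Proof.
move=> pk; have := lts_cyclic ax k x y.
by rewrite (tern_kernel3 _ _ pk) (tern_kernel2 _ _ pk) !addr0.
Qed.

(* With s a formal sum of pairs, this is the {x, s} of the introduction. *)
Let act x s : U := eval_sum (lts_br x) s.

Let act_linear s c u v : act (c *: u + v) s = c *: act u s + act v s.
Proof.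
rewrite /act /eval_sum scaler_sumr -big_split; apply: eq_bigr => t _ /=.
by rewrite tern_P1 scalerDr !scalerA mulrC.
Qed.

Let p_act x s : p (act x s) = lie_br g (p x) (eval_sum pbr s).
Proof.
rewrite /act /eval_sum linear_sum linear_sumr; apply: eq_bigr => t _.
by rewrite linearZ /= p_tern linearZr.
Qed.

Lemma act_derivation x y z s :
  act {x, y, z} s = {act x s, y, z} + {x, act y s, z} + {x, y, act z s}.
Proof.
rewrite /act; elim: s => [|[[c a] b] s IH].
  rewrite /eval_sum !big_nil.
  have p0 : p 0 = 0 by rewrite linear0.
  by rewrite (tern_kernel1 _ _ p0) (tern_kernel2 _ _ p0) tern_kernel3 // !addr0.
have cons (w : U) : eval_sum (lts_br w) ((c, a, b) :: s)
    = c *: {w, a, b} + eval_sum (lts_br w) s by rewrite /eval_sum big_cons.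
rewrite !cons tern_P1 tern_P2 tern_P3 IH (lts_derivation ax) !scalerDr.
by rewrite [LHS](AC (3*3) ((1*4)*(2*5)*(3*6))).
Qed.

(** The crucial well-definedness statement: if s has bracket 0 in g, then every
    act y s lies over 0 and is central, so [act_derivation] shows that act _ s
    kills the triple products; it also kills the kernel of p, and together
    these span U. *)
Lemma act_eq0 x s : eval_sum pbr s = 0 -> act x s = 0.
Proof.
move=> s0; have pact0 y : p (act y s) = 0 by rewrite p_act s0 linear0r.
elim/(ext_ind2 g_perfect p_surj): x => [c u v Pu Pv | x a b c px].
  by rewrite act_linear Pu Pv scaler0 addr0.
rewrite -[x](subrK {a, b, c}) -[x - _]scale1r act_linear act_derivation.
rewrite (tern_kernel1 _ _ (pact0 a)) (tern_kernel2 _ _ (pact0 b)).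
rewrite (tern_kernel3 _ _ (pact0 c)) !addr0 scale1r.
rewrite /act /eval_sum big1 // => t _.
by rewrite tern_kernel1 ?scaler0 // linearB px p_tern subrr.
Qed.

Lemma act_combination x c s s1 s2 :
    eval_sum pbr s = c *: eval_sum pbr s1 + eval_sum pbr s2 ->
  act x s = c *: act x s1 + act x s2.
Proof.
move=> def_s; apply/eqP; rewrite -subr_eq0; apply/eqP.
have := @act_eq0 x (s ++ scale_sum (- 1) (scale_sum c s1 ++ s2)).
rewrite /act !(eval_cat, eval_scale) !scaleN1r; apply.
by rewrite def_s subrr.
Qed.

Lemma ext_pairs y : exists s, eval_sum pbr s = p y.
Proof.
elim/(ext_ind g_perfect p_surj): y => [c u v [s1 s1P] [s2 s2P] | y a b ->].
  by exists (scale_sum c s1 ++ s2); rewrite eval_cat eval_scale s1P s2P linearP.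
by exists [:: (1, a, b)]; rewrite eval_sum1.
Qed.

(** The bracket br x y is act x s for any s over p y; it is independent of the
    choice of s by [act_combination]. *)
Lemma leibniz_bracket_of_lts_ext : exists br : {bilinear U -> U -> U},
  [/\ forall x y, p (br x y) = lie_br g (p x) (p y),
      forall k x, p k = 0 -> br x k = 0 /\ br k x = 0,
      forall x y z, br x (br y z) = {x, y, z} &
      forall x y z, br x (br y z) = br (br x y) z - br (br x z) y].
Proof.
pose dec y := sval (constructive_indefinite_description _ (ext_pairs y)).
have decP y : eval_sum pbr (dec y) = p y.
  by rewrite /dec; case: constructive_indefinite_description.
pose br0 x y := act x (dec y).
have br0_bilin : bilinear_for *:%R *:%R br0.
  split=> [y c u v | x c u v]; first exact: act_linear.
  by apply: act_combination; rewrite !decP linearP.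
pose br : {bilinear U -> U -> U} :=
  HB.pack br0 (bilinear_isBilinear.Build F U U U *:%R *:%R br0 br0_bilin).
have p_br x y : p (br x y) = lie_br g (p x) (p y) by rewrite p_act decP.
have brE x y a b : p y = lie_br g (p a) (p b) -> br x y = {x, a, b}.
  move=> py; rewrite /= /br0.
  rewrite (@act_combination x 0 _ [::] [:: (1, a, b)]) ?scale0r ?add0r.
    by rewrite /act eval_sum1.
  by rewrite eval_sum1 decP.
have br_kernel x k : p k = 0 -> br x k = 0.
  move=> pk; rewrite (brE x k k k) ?tern_kernel3 // pk.
  by rewrite linear0r.
exists br; split=> // [k x pk | x y z |].
- split; first exact: br_kernel.
  by rewrite /= /br0 /act /eval_sum big1 // => t _; rewrite tern_kernel1 ?scaler0.
- exact: brE.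
have br_derivation v x y z :
    br {x, y, z} v = {br x v, y, z} + {x, br y v, z} + {x, y, br z v}.
  exact: act_derivation.
move=> x w v.
(* For w over a single bracket [p a, p b], the Leibniz identity is
   br_derivation on {x, a, b} = br x w. *)
elim/(ext_ind g_perfect p_surj): w x => [c w1 w2 IH1 IH2 | w a b pw] x.
  rewrite linearPl !linearPr IH1 IH2 linearPl /= scalerBr opprD.
  by rewrite [LHS](AC (2*2) ((1*3)*(2*4))).
rewrite !(brE _ _ _ _ pw) br_derivation.
have D (u1 u2 u3 : g) : lie_br g (lie_br g u1 u2) u3
    = lie_br g (lie_br g u1 u3) u2 + lie_br g u1 (lie_br g u2 u3).
  by rewrite (lie_leibniz_identity u1) addrC subrK.
have -> : br x (br w v) = br x (br (br a v) b + br a (br b v)).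
  apply: subr0_eq; rewrite -linearBr br_kernel //.
  by rewrite linearB linearD !p_br pw D subrr.
rewrite linearDr (brE x _ (br a v) b) // (brE x _ a (br b v)) //.
by rewrite [RHS]addrC -[in RHS]addrA addKr.
Qed.

End LeibnizBracket.

(** * Central extensions of Leibniz algebras *)

Section LeibnizExtension.
Variables (F : fieldType) (g : lieAlgebra F) (h : leibnizAlgebra F).
Variables (q : leib_hom h (leibniz_of_lie g)).
Hypothesis q_central : leib_central_ext q.

Local Notation "[| x , y |]" := (leib_br h x y).

Let q_br x y : q [|x, y|] = lie_br g (q x) (q y) := leib_hom_br q x y.

(** The bracket of a central extension factors through g. *)
Lemma leib_central_congr x y y' : q y = q y' ->
  [|x, y|] = [|x, y'|] /\ [|y, x|] = [|y', x|].
Proof.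
move=> eq_q; have q0 : q (y - y') = 0 by rewrite linearB eq_q subrr.
have [xk kx] := q_central.2 x _ q0.
by split; apply: subr0_eq; rewrite -(linearBr, linearBl).
Qed.

(** The bracket of h itself may fail to be antisymmetric, but
    [x, y] + [y, x] lies over 0 and is therefore central. *)
Lemma leib_central_antisym x y z : [|[|x, y|], z|] = - [|[|y, x|], z|].
Proof.
have qxy : q [|x, y|] = q (- [|y, x|]).
  by rewrite linearN !q_br; apply: lie_anticomm.
by have [_ ->] := leib_central_congr z qxy; rewrite linearNl.
Qed.

(** The Leibniz identity splits each [x, [y, z]] into [[x, y], z] and
    [[z, x], y], so each double bracket on the right arises twice. *)
Lemma leib_ternary_cyclic_sum x y z :
  leib_ternary x y z + leib_ternary y z x + leib_ternary z x y
    = ([|[|x, y|], z|] + [|[|y, z|], x|] + [|[|z, x|], y|]) *+ 2.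
Proof.
rewrite /leib_ternary !leib_identity.
rewrite (leib_central_antisym x z) (leib_central_antisym y x).
rewrite (leib_central_antisym z y) !opprK mulr2n.
set A := [|[|x, y|], z|]; set B := [|[|y, z|], x|]; set C := [|[|z, x|], y|].
by rewrite [LHS](AC (2*2*2) ((1*3*5)*(4*6*2))).
Qed.

(** The derivation identity is the Leibniz identity for right multiplication by
    [a, b], and {x, y, y} = 0 because [y, y] is central; only the cyclic
    identity is a genuine condition. *)
Lemma leib_ternaryP :
    (forall x y z : h,
      leib_ternary x y z + leib_ternary y z x + leib_ternary z x y = 0) ->
  lts_axioms (@leib_ternary F h).
Proof.
move=> cyclic; split; rewrite /leib_ternary //.
- by move=> y z c u v; rewrite linearPl.
- by move=> x z c u v; rewrite linearPl linearPr.
- by move=> x y c u v; rewrite !linearPr.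
- move=> x y; apply: (q_central.2 x _ _).1.
  by rewrite q_br; apply: lie_alt.
move=> x y z a b; set t := [|a, b|].
have D u v : [|[|u, v|], t|] = [|[|u, t|], v|] + [|u, [|v, t|]|].
  by rewrite (leib_identity u v t) addrC subrK.
by rewrite !D linearDr addrA.
Qed.

Lemma leib_ternaryP_pchar2 : 2%N \in GRing.pchar F ->
  lts_axioms (@leib_ternary F h).
Proof.
move=> F2; apply: leib_ternaryP => x y z.
by rewrite leib_ternary_cyclic_sum -scaler_nat (pcharf0 F2) scale0r.
Qed.

Hypothesis g_perfect : perfect g.

(** By [leib_ternary_cyclic_sum] the cyclic sum of [[x, a], b] vanishes, which
    the Leibniz identity turns into [x, [a, b]] + [[a, b], x] = 0; brackets
    [a, b] are enough since g is perfect. *)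
Lemma leib_ext_alternating : 2%N \notin GRing.pchar F ->
    (forall x y z : h,
      leib_ternary x y z + leib_ternary y z x + leib_ternary z x y = 0) ->
  forall x, [|x, x|] = 0.
Proof.
rewrite inE /= => F2 cyclic.
have double_eq0 (u : h) : u *+ 2 = 0 -> u = 0.
  by move/eqP; rewrite -scaler_nat scaler_eq0 (negPf F2) => /= /eqP.
suff antisym x y : [|x, y|] + [|y, x|] = 0.
  by move=> x; apply: double_eq0; rewrite mulr2n.
elim/(ext_ind g_perfect q_central.1): y => [c u v Pu Pv | y a b qy].
  rewrite linearPr linearPl /= addrACA -scalerDr.
  by rewrite Pu Pv scaler0 addr0.
have [-> ->] := @leib_central_congr x y [|a, b|] (etrans qy (esym (q_br a b))).
have := leib_ternary_cyclic_sum x a b; rewrite cyclic => /esym/double_eq0.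
by rewrite leib_identity (leib_central_antisym x b) opprK addrAC.
Qed.

End LeibnizExtension.

Section Transport.
Variables (F : fieldType) (g : lieAlgebra F) (g_perfect : perfect g).

(** A bracket [x, y] depends only on the image of y in g, so y may be replaced
    by a bracket [a, b], and [x, [a, b]] is a ternary product. *)
Lemma ternary_hom_leib (V W : leibnizAlgebra F)
    (p : leib_hom V (leibniz_of_lie g)) (q : leib_hom W (leibniz_of_lie g))
    (h : {linear V -> W}) :
    leib_central_ext p -> leib_central_ext q -> (forall x, q (h x) = p x) ->
    (forall x y z, h (leib_ternary x y z) = leib_ternary (h x) (h y) (h z)) ->
  forall x y, h (leib_br V x y) = leib_br W (h x) (h y).
Proof.
move=> p_central q_central qh h_tern x y.
elim/(ext_ind g_perfect p_central.1): y => [c u v Pu Pv | y a b py].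
  by rewrite linearPr !linearP Pu Pv.
have py' : p y = p (leib_br V a b) by rewrite py leib_hom_br.
have qy : q (h y) = q (leib_br W (h a) (h b)) by rewrite leib_hom_br !qh.
have [-> _] := leib_central_congr p_central x py'.
have [-> _] := leib_central_congr q_central (h x) qy.
exact: h_tern.
Qed.

End Transport.

(** * Comparison of the universal central extensions *)

Section Rigidity.
Variable F : fieldType.

(* These lemmas take a plain linear map, so that composites can be used without
   packing them as homomorphisms. *)

Lemma lts_universal_rigid (U g : lieTripleSystem F) (p : lts_hom U g)
    (f : {linear U -> U}) :
    lts_universal_ext p -> (forall x, p (f x) = p x) ->
    (forall x y z, f (lts_br x y z) = lts_br (f x) (f y) (f z)) ->
  f =1 id.
Proof.
move=> [p_central univ] pf f_br x; have [f0 [_ uniq]] := univ U p p_central.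
have id_br (u v w : U) : (idfun : {linear U -> U}) (lts_br u v w) = lts_br u v w.
  by [].
by rewrite (uniq (LtsHom f_br) pf) -(uniq (LtsHom id_br)).
Qed.

Lemma leib_universal_rigid (U g : leibnizAlgebra F) (p : leib_hom U g)
    (f : {linear U -> U}) :
    leib_universal_ext p -> (forall x, p (f x) = p x) ->
    (forall x y, f (leib_br U x y) = leib_br U (f x) (f y)) ->
  f =1 id.
Proof.
move=> [p_central univ] pf f_br x; have [f0 [_ uniq]] := univ U p p_central.
have id_br (u v : U) : (idfun : {linear U -> U}) (leib_br U u v) = leib_br U u v.
  by [].
by rewrite (uniq (LeibHom f_br) pf) -(uniq (LeibHom id_br)).
Qed.

Lemma lie_universal_rigid (U g : lieAlgebra F) (p : lie_hom U g)
    (f : {linear U -> U}) :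
    lie_universal_ext p -> (forall x, p (f x) = p x) ->
    (forall x y, f (lie_br U x y) = lie_br U (f x) (f y)) ->
  f =1 id.
Proof.
move=> [p_central univ] pf f_br x; have [f0 [_ uniq]] := univ U p p_central.
have id_br (u v : U) : (idfun : {linear U -> U}) (lie_br U u v) = lie_br U u v.
  by [].
by rewrite (uniq (LieHom f_br) pf) -(uniq (LieHom id_br)).
Qed.

End Rigidity.

Section Comparison.
Variables (F : fieldType) (g : lieAlgebra F) (g_perfect : perfect g).
Variables (U : lieTripleSystem F) (p : lts_hom U (lts_of_lie g)).
Hypothesis p_univ : lts_universal_ext p.

(** With V the carrier of U under its Leibniz bracket, universality of W gives
    f : W -> V and universality of U gives h : U -> W.  The composite f \o h is
    an endomorphism of triple systems; h \o f is one of Leibniz algebras because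
    h preserves the binary bracket. *)
Lemma lts_universal_iso_leib (W : leibnizAlgebra F)
    (q : leib_hom W (leibniz_of_lie g)) (H : lts_axioms (@leib_ternary F W)) :
  leib_universal_ext q -> @lts_iso_over F U (lts_of_leibniz H) g p q.
Proof.
move=> q_univ.
have [br [p_br br_kernel br_tern br_leib]] :=
  leibniz_bracket_of_lts_ext g_perfect p_univ.1.
pose V := LeibnizAlgebra br_leib.
pose pV : leib_hom V (leibniz_of_lie g) :=
  @LeibHom F V (leibniz_of_lie g) (lts_map p) p_br.
have pV_central : leib_central_ext pV.
  by split; [exact: p_univ.1.1 | move=> x k; apply: br_kernel].
have q_br (x y z : lts_of_leibniz H) :
    q (lts_br x y z) = @lts_br F (lts_of_lie g) (q x) (q y) (q z).
  by rewrite /= /leib_ternary !leib_hom_br.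
pose qT := @LtsHom F (lts_of_leibniz H) (lts_of_lie g) (leib_map q) q_br.
have qT_central : lts_central_ext qT.
  split; first exact: q_univ.1.1.
  move=> x y k qk; rewrite /= /leib_ternary.
  by rewrite (q_univ.1.2 y k qk).1 linear0r.
have [f [pf _]] := q_univ.2 V pV pV_central.
have [h [qh _]] := p_univ.2 _ qT qT_central.
have h_tern (x y z : V) :
    h (leib_ternary x y z) = leib_ternary (h x : W) (h y) (h z).
  by rewrite /leib_ternary /= br_tern; exact: (lts_hom_br h x y z).
have h_br := ternary_hom_leib g_perfect pV_central q_univ.1 qh h_tern.
exists h; split=> //; exists f => x.
  apply: (lts_universal_rigid (f := f \o h) p_univ) => [y | y z w] /=.
    by rewrite (pf (h y)); apply: qh.
  by rewrite lts_hom_br /= /leib_ternary !leib_hom_br /= br_tern.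
apply: (leib_universal_rigid (f := h \o f) q_univ) => [y | y z] /=.
  by rewrite (qh (f y)); apply: pf.
by rewrite leib_hom_br; apply: h_br.
Qed.

(** The argument of [lts_universal_iso_leib] applies because U is now a Lie
    algebra: the Jacobi identity for br is the cyclic identity of U. *)
Lemma lts_universal_iso_lie (W : lieAlgebra F) (q : lie_hom W g) :
    2%N \notin GRing.pchar F -> lie_universal_ext q ->
  @lts_iso_over F U (lts_of_lie W) g p q.
Proof.
move=> F2 q_univ.
have [br [p_br br_kernel br_tern br_leib]] :=
  leibniz_bracket_of_lts_ext g_perfect p_univ.1.
pose V := LeibnizAlgebra br_leib.
pose pV : leib_hom V (leibniz_of_lie g) :=
  @LeibHom F V (leibniz_of_lie g) (lts_map p) p_br.
have pV_central : leib_central_ext pV.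
  by split; [exact: p_univ.1.1 | move=> x k; apply: br_kernel].
have br_jacobi (x y z : U) : br x (br y z) + br y (br z x) + br z (br x y) = 0.
  by rewrite !br_tern; apply: lts_cyclic (ltsP U) x y z.
have br_alt x : br x x = 0.
  exact: (leib_ext_alternating pV_central g_perfect F2 br_jacobi).
pose VLie := LieAlgebra br_alt br_jacobi.
pose pL : lie_hom VLie g := @LieHom F VLie g (lts_map p) p_br.
have pL_central : lie_central_ext pL by exact: pV_central.
have q_tern (x y z : lts_of_lie W) :
    q (lts_br x y z) = @lts_br F (lts_of_lie g) (q x) (q y) (q z).
  by rewrite /= /lie_ternary !lie_hom_br.
pose qT := @LtsHom F (lts_of_lie W) (lts_of_lie g) (lie_map q) q_tern.
have qT_central : lts_central_ext qT.
  split; first exact: q_univ.1.1.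
  move=> x y k qk; rewrite /= /lie_ternary.
  by rewrite (q_univ.1.2 y k qk).1 linear0r.
pose qV : leib_hom (leibniz_of_lie W) (leibniz_of_lie g) :=
  @LeibHom F (leibniz_of_lie W) (leibniz_of_lie g) (lie_map q) (lie_hom_br q).
have qV_central : leib_central_ext qV by exact: q_univ.1.
have [f [pf _]] := q_univ.2 VLie pL pL_central.
have [h [qh _]] := p_univ.2 _ qT qT_central.
have h_tern (x y z : V) :
    h (leib_ternary x y z) = lie_ternary (h x : W) (h y) (h z).
  by rewrite /leib_ternary /= br_tern; exact: (lts_hom_br h x y z).
have h_br := ternary_hom_leib g_perfect pV_central qV_central qh h_tern.
exists h; split=> //; exists f => x.
  apply: (lts_universal_rigid (f := f \o h) p_univ) => [y | y z w] /=.
    by rewrite (pf (h y)); apply: qh.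
  by rewrite lts_hom_br /= /lie_ternary !lie_hom_br /= br_tern.
apply: (lie_universal_rigid (f := h \o f) q_univ) => [y | y z] /=.
  by rewrite (qh (f y)); apply: pf.
by rewrite lie_hom_br; apply: h_br.
Qed.

End Comparison.

Theorem theorem1 (F : fieldType) (g : lieAlgebra F) (g_perfect : perfect g)
    (ULTS : lieTripleSystem F) (pLTS : lts_hom ULTS (lts_of_lie g))
    (pLTS_univ : lts_universal_ext pLTS)
    (ULeib : leibnizAlgebra F) (pLeib : leib_hom ULeib (leibniz_of_lie g))
    (pLeib_univ : leib_universal_ext pLeib)
    (ULie : lieAlgebra F) (pLie : lie_hom ULie g)
    (pLie_univ : lie_universal_ext pLie) :
  (2%N \in GRing.pchar F ->
     exists H : lts_axioms (@leib_ternary F ULeib),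
       @lts_iso_over F ULTS (lts_of_leibniz H) g pLTS pLeib) /\
  (2%N \notin GRing.pchar F ->
     @lts_iso_over F ULTS (lts_of_lie ULie) g pLTS pLie).
Proof.
split=> F2; last exact: lts_universal_iso_lie.
exists (leib_ternaryP_pchar2 pLeib_univ.1 F2).
exact: lts_universal_iso_leib.
Qed.
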